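(* Let $(\mathcal{G}\rightrightarrows M,\varpi)$ be a 0-shifted symplectic groupoid, let $\mathcal{H}\rightrightarrows N$ be a Lie groupoid and $\Phi:\mathcal{H}\to\mathcal{G}$ a Lie groupoid morphism with restriction $\phi=\Phi|_N:N\to M$ to units. Then $\Phi$ is isotropic if and only if $\phi^*\varpi=0$, and it is lagrangian if and only if, additionally, $\mathcal{H}$ has injective anchor $\mathtt{a}_{\mathcal{H}}$, the map $TN/\mathtt{a}_{\mathcal{H}}(A_{\mathcal{H}})\to\phi^*(TM/\mathtt{a}_{\mathcal{G}}(A_{\mathcal{G}}))$ induced by $T\phi$ is injective, and $$\mathrm{rank}(TN/\mathtt{a}_{\mathcal{H}}(A_{\mathcal{H}}))=\tfrac12\,\mathrm{rank}(TM/\mathtt{a}_{\mathcal{G}}(A_{\mathcal{G}})).$$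
   Context: Everything is real and $C^\infty$. For a Lie groupoid $\mathcal{G}\rightrightarrows M$ with source $\mathtt{s}$ and target $\mathtt{t}$, $A_{\mathcal{G}}=\ker(T\mathtt{s})|_M$ is its Lie algebroid, with anchor $\mathtt{a}_{\mathcal{G}}=T\mathtt{t}:A_{\mathcal{G}}\to TM$. A 0-shifted symplectic structure on $\mathcal{G}\rightrightarrows M$ is a 2-form $\varpi\in\Omega^2(M)$ with $d\varpi=0$, $\mathtt{s}^*\varpi=\mathtt{t}^*\varpi$, which is nondegenerate: the chain map from $A_{\mathcal{G}}\xrightarrow{\mathtt{a}_{\mathcal{G}}}TM\to0$ to $0\to T^*M\xrightarrow{-\mathtt{a}_{\mathcal{G}}^*}A_{\mathcal{G}}^*$ given by $\varpi^\flat:TM\to T^*M$ is a quasi-isomorphism; equivalently $\mathtt{a}_{\mathcal{G}}$ is injective and $\varpi^\flat$ induces an isomorphism $TM/\mathtt{a}_{\mathcal{G}}(A_{\mathcal{G}})\to(TM/\mathtt{a}_{\mathcal{G}}(A_{\mathcal{G}}))^*$. An isotropic structure on $\Phi:\mathcal{H}\to\mathcal{G}$ is a $(-1)$-shifted 2-form $\sigma$ whose total differential equals $\Phi^*\varpi$; since there are no nonzero $(-1)$-shifted forms, $\sigma=0$ and $\Phi$ is isotropic when the pullback of the 0-shifted form $\varpi$ by $\Phi$, namely $\phi^*\varpi$, is zero. The isotropic morphism $\Phi$ is lagrangian if the chain map from its normal complex $A_{\mathcal{H}}\xrightarrow{(\mathtt{a}_{\mathcal{H}},\mathrm{Lie}(\Phi))}TN\oplus\phi^*A_{\mathcal{G}}\xrightarrow{T\phi-\mathtt{a}_{\mathcal{G}}}\phi^*TM$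 to the (shifted) cotangent complex $T^*N\xrightarrow{-\mathtt{a}_{\mathcal{H}}^*}A_{\mathcal{H}}^*$, given by $T^*\phi\circ\varpi^\flat:\phi^*TM\to T^*N$ (with $\phi^*TM$ and $T^*N$ in the same degree), is a quasi-isomorphism; equivalently the sequence $$0\to A_{\mathcal{H}}\xrightarrow{(\mathtt{a}_{\mathcal{H}},\mathrm{Lie}(\Phi))}TN\oplus\phi^*A_{\mathcal{G}}\xrightarrow{T\phi-\mathtt{a}_{\mathcal{G}}}\phi^*TM\xrightarrow{T^*\phi\circ\varpi^\flat}T^*N\xrightarrow{-\mathtt{a}_{\mathcal{H}}^*}A_{\mathcal{H}}^*\to0$$ of vector bundles over $N$ is exact. *)

(* Defs.v *)
From HB Require Import structures.
From mathcomp Require Import all_boot all_order all_algebra.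
From mathcomp Require Import all_classical all_reals all_analysis.

Set Implicit Arguments.
Unset Strict Implicit.
Unset Printing Implicit Defensive.

Import Order.TTheory GRing.Theory Num.Theory.
Import numFieldNormedType.Exports.

Local Open Scope classical_set_scope.
Local Open Scope ring_scope.


(* Only meant for U open and V, W finite-dimensional: then 'D_v f depends near
   points of U only on f restricted to U, and this is the usual class C^k. *)
Fixpoint Ck_on (R : realType) (V W : normedModType R) (k : nat) (U : set V)
    (f : V -> W) : Prop :=
  match k with
  | 0 => forall x, U x -> {for x, continuous f}
  | k'.+1 => (forall x, U x -> differentiable f x) /\
             (forall v, Ck_on k' U (fun x => 'D_v f x))
  end.

Definition smooth_on (R : realType) (V W : normedModType R) (U : set V)
    (f : V -> W) : Prop := forall k, Ck_on k U f.


(* chart_map and chart_inv are total functions whose values matter only on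
   chart_dom and chart_cod. *)
Record chart (R : realType) (M : topologicalType) (n : nat) := Chart {
  chart_dom : set M;
  chart_cod : set 'rV[R]_n;
  chart_map : M -> 'rV[R]_n;
  chart_inv : 'rV[R]_n -> M;
  chart_dom_open : open chart_dom;
  chart_cod_open : open chart_cod;
  chart_map_cod : forall p, chart_dom p -> chart_cod (chart_map p);
  chart_inv_dom : forall y, chart_cod y -> chart_dom (chart_inv y);
  chart_mapK : forall p, chart_dom p -> chart_inv (chart_map p) = p;
  chart_invK : forall y, chart_cod y -> chart_map (chart_inv y) = y;
  chart_map_cont : forall p, chart_dom p -> {for p, continuous chart_map};
  chart_inv_cont : forall y, chart_cod y -> {for y, continuous chart_inv}
}.

(* chart_at selects one chart of the atlas around each point; its only role is
   to identify the tangent space at p with R^n, see tangent below. *)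
Record manifold (R : realType) := Manifold {
  pts :> topologicalType;
  mdim : nat;
  atlas : set (chart R pts mdim);
  chart_at : pts -> chart R pts mdim;
  mfd_hausdorff : hausdorff_space pts;
  mfd_second_countable : @second_countable pts;
  chart_at_atlas : forall p, atlas (chart_at p);
  chart_at_dom : forall p, chart_dom (chart_at p) p;
  atlas_compatible : forall c c', atlas c -> atlas c' ->
    smooth_on (chart_cod c `&` chart_inv c @^-1` chart_dom c')
              (chart_map c' \o chart_inv c)
}.

Definition smooth_map (R : realType) (M N : manifold R) (f : M -> N) : Prop :=
  continuous f /\
  forall (c : chart R M (mdim M)) (c' : chart R N (mdim N)),
    atlas c -> atlas c' ->
    smooth_on (chart_cod c `&` (f \o chart_inv c) @^-1` chart_dom c')
              (chart_map c' \o f \o chart_inv c).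

(* The class of a curve gamma with gamma 0 = p is represented by the velocity at
   0 of chart_map (chart_at p) \o gamma.  The type does not depend on p. *)
Definition tangent (R : realType) (M : manifold R) : vectType R :=
  'rV[R]_(mdim M).

Definition tmap (R : realType) (M N : manifold R) (f : M -> N) (p : M) :
    'Hom(tangent M, tangent N) :=
  let F := chart_map (chart_at (f p)) \o f \o chart_inv (chart_at p) in
  linfun ('d F (chart_map (chart_at p) p) : 'rV[R]_(mdim M) -> 'rV[R]_(mdim N)).

(* Tangent map of the parametrization chart_inv c : chart_cod c -> M at y. *)
Definition tparam (R : realType) (M : manifold R) (c : chart R M (mdim M))
    (y : 'rV[R]_(mdim M)) : tangent M -> tangent M :=
  'd (chart_map (chart_at (chart_inv c y)) \o chart_inv c) y.


Definition form_fun (R : realType) (M : manifold R) :=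
  M -> tangent M -> tangent M -> R.

(* Coefficient of om on the constant vector fields v, w of the chart c. *)
Definition form_in_chart (R : realType) (M : manifold R) (om : form_fun M)
    (c : chart R M (mdim M)) (v w : 'rV[R]_(mdim M)) : 'rV[R]_(mdim M) -> R^o :=
  fun y => om (chart_inv c y) (tparam c y v) (tparam c y w).

Record two_form (R : realType) (M : manifold R) := TwoForm {
  form_val :> form_fun M;
  form_linear_l : forall p w a v1 v2,
    form_val p (a *: v1 + v2) w = a * form_val p v1 w + form_val p v2 w;
  form_linear_r : forall p v a w1 w2,
    form_val p v (a *: w1 + w2) = a * form_val p v w1 + form_val p v w2;
  form_alternating : forall p v, form_val p v v = 0;
  form_smooth : forall c, atlas c ->
    forall v w, smooth_on (chart_cod c) (form_in_chart form_val c v w)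
}.

(* The left-hand side is d om evaluated on constant vector fields u, v, w. *)
Definition closed_form (R : realType) (M : manifold R) (om : two_form M) : Prop :=
  forall c, atlas c -> forall y, chart_cod c y -> forall u v w,
    'D_u (form_in_chart om c v w) y + 'D_v (form_in_chart om c w u) y
      + 'D_w (form_in_chart om c u v) y = 0.

Definition zero_form (R : realType) (M : manifold R) : form_fun M :=
  fun _ _ _ => 0.
Arguments zero_form {R} M _ _ _.

Definition pullback (R : realType) (M N : manifold R) (f : M -> N)
    (om : form_fun N) : form_fun M :=
  fun p v w => om (f p) (tmap f p v) (tmap f p w).


(* g h is composable when s g = t h; gmul is total, with irrelevant values on
   non-composable pairs.  Since s and t are submersions, the composable pairs
   form an embedded submanifold of arr * arr, so that smoothness of the
   multiplication means that, locally, it extends to a smooth map on an open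
   set: this is gmul_smooth, written in charts. *)
Record lie_groupoid (R : realType) := LieGroupoid {
  arr : manifold R;
  obj : manifold R;
  src : arr -> obj;
  tgt : arr -> obj;
  gunit : obj -> arr;
  ginv : arr -> arr;
  gmul : arr -> arr -> arr;
  src_smooth : smooth_map src;
  tgt_smooth : smooth_map tgt;
  gunit_smooth : smooth_map gunit;
  ginv_smooth : smooth_map ginv;
  src_surj : forall x, exists g, src g = x;
  tgt_surj : forall x, exists g, tgt g = x;
  src_submersion : forall g, limg (tmap src g) = fullv;
  tgt_submersion : forall g, limg (tmap tgt g) = fullv;
  gmul_smooth : forall (g h : arr) (c1 c2 c3 : chart R arr (mdim arr)),
    src g = tgt h -> atlas c1 -> atlas c2 -> atlas c3 ->
    chart_dom c1 g -> chart_dom c2 h -> chart_dom c3 (gmul g h) ->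
    exists (W : set ('rV[R]_(mdim arr) * 'rV[R]_(mdim arr))%type)
           (F : ('rV[R]_(mdim arr) * 'rV[R]_(mdim arr))%type ->
                'rV[R]_(mdim arr)),
      [/\ open W, W (chart_map c1 g, chart_map c2 h), smooth_on W F &
          forall g' h', chart_dom c1 g' -> chart_dom c2 h' -> src g' = tgt h' ->
            W (chart_map c1 g', chart_map c2 h') ->
            chart_dom c3 (gmul g' h') /\
            chart_map c3 (gmul g' h') = F (chart_map c1 g', chart_map c2 h')];
  src_unit : forall x, src (gunit x) = x;
  tgt_unit : forall x, tgt (gunit x) = x;
  src_inv : forall g, src (ginv g) = tgt g;
  tgt_inv : forall g, tgt (ginv g) = src g;
  src_mul : forall g h, src g = tgt h -> src (gmul g h) = src h;
  tgt_mul : forall g h, src g = tgt h -> tgt (gmul g h) = tgt g;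
  gmulA : forall g h k, src g = tgt h -> src h = tgt k ->
    gmul g (gmul h k) = gmul (gmul g h) k;
  gmul1 : forall g, gmul g (gunit (src g)) = g;
  gmul1l : forall g, gmul (gunit (tgt g)) g = g;
  gmulV : forall g, gmul g (ginv g) = gunit (tgt g);
  gmulVl : forall g, gmul (ginv g) g = gunit (src g)
}.

Record lie_morphism (R : realType) (H G : lie_groupoid R) := LieMorphism {
  mor_arr : arr H -> arr G;
  mor_obj : obj H -> obj G;
  mor_arr_smooth : smooth_map mor_arr;
  mor_obj_smooth : smooth_map mor_obj;
  mor_src : forall h, src (mor_arr h) = mor_obj (src h);
  mor_tgt : forall h, tgt (mor_arr h) = mor_obj (tgt h);
  mor_unit : forall y, mor_arr (gunit y) = gunit (mor_obj y);
  mor_mul : forall h k, src h = tgt k ->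
    mor_arr (gmul h k) = gmul (mor_arr h) (mor_arr k)
}.

Definition algebroid_sub (R : realType) (G : lie_groupoid R) (x : obj G) :
    {vspace tangent (arr G)} :=
  lker (tmap (@src R G) (gunit x)).

Definition algebroid (R : realType) (G : lie_groupoid R) (x : obj G) :
    vectType R :=
  subvs_of (algebroid_sub x).

Definition anchor (R : realType) (G : lie_groupoid R) (x : obj G) :
    'Hom(algebroid x, tangent (obj G)) :=
  linfun (fun v : algebroid x => tmap (@tgt R G) (gunit x) (vsval v)).

(* The tangent map of mor_arr at a unit maps ker (T src) to ker (T src); vsproj
   only restricts the codomain accordingly. *)
Definition lie_map (R : realType) (H G : lie_groupoid R)
    (Phi : lie_morphism H G) (y : obj H) :
    'Hom(algebroid y, algebroid (mor_obj Phi y)) :=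
  linfun (fun v : algebroid y =>
    vsproj (algebroid_sub (mor_obj Phi y))
           (tmap (mor_arr Phi) (gunit y) (vsval v))).


(* Injectivity of the map V / U -> V' / U' induced by f, on representatives. *)
Definition quot_injective (R : realType) (V V' : vectType R)
    (f : 'Hom(V, V')) (U : {vspace V}) (U' : {vspace V'}) : Prop :=
  forall v w, f v - f w \in U' -> v - w \in U.

Definition quot_rank (R : realType) (V : vectType R) (U : {vspace V}) : nat :=
  (\dim (fullv : {vspace V}) - \dim U)%N.

Definition dual (R : realType) (V : vectType R) : vectType R := 'Hom(V, R^o).

Definition dual_map (R : realType) (V W : vectType R) (f : 'Hom(V, W)) :
    'Hom(dual W, dual V) :=
  linfun (fun xi : 'Hom(W, R^o) => (xi \o f)%VF : dual V).

Definition zero_space (R : realType) : vectType R := 'rV[R]_0.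

Record cochain (R : realType) := Cochain {
  term : nat -> vectType R;
  cdiff : forall i, 'Hom(term i, term i.+1)
}.

Definition is_complex (R : realType) (C : cochain R) : Prop :=
  forall i (v : term C i), cdiff C i.+1 (cdiff C i v) = 0.

Definition is_chain_map (R : realType) (C D : cochain R)
    (f : forall i, 'Hom(term C i, term D i)) : Prop :=
  forall i (v : term C i), cdiff D i (f i v) = f i.+1 (cdiff C i v).

Definition cocycles (R : realType) (C : cochain R) (i : nat) :
    {vspace term C i} := lker (cdiff C i).

Definition coboundaries (R : realType) (C : cochain R) (i : nat) :
    {vspace term C i} :=
  match i return {vspace term C i} with
  | 0 => 0%VS
  | j.+1 => limg (cdiff C j)
  end.

(* The last two clauses say that the map induced on
   H^i = cocycles i / coboundaries i is injective and surjective. *)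
Definition quasi_iso (R : realType) (C D : cochain R)
    (f : forall i, 'Hom(term C i, term D i)) : Prop :=
  [/\ is_complex C, is_complex D, is_chain_map f,
      (forall i (v w : term C i), v \in cocycles C i -> w \in cocycles C i ->
         f i v - f i w \in coboundaries D i -> v - w \in coboundaries C i) &
      (forall i (v' : term D i), v' \in cocycles D i ->
         exists2 v, v \in cocycles C i & f i v - v' \in coboundaries D i)].


Definition flat (R : realType) (M : manifold R) (om : two_form M) (x : M) :
    'Hom(tangent M, dual (tangent M)) :=
  linfun (fun v : tangent M =>
    linfun (fun w : tangent M => form_val om x v w : R^o) : dual (tangent M)).

(* The complexes are indexed from 0 at their leftmost term. *)

(* A_G -> TM -> 0, at x *)
Definition tangent_complex (R : realType) (G : lie_groupoid R) (x : obj G) :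
    cochain R :=
  let T := fun i : nat => match i with
           | 0 => algebroid x
           | 1 => tangent (obj G)
           | _ => zero_space R
           end in
  @Cochain R T (fun i => match i return 'Hom(T i, T i.+1) with
                         | 0 => anchor x
                         | _.+1 => 0
                         end).

(* 0 -> T^*M -> A_G^*, at x; its shift by one is used for lagrangian morphisms *)
Definition cotangent_complex (R : realType) (G : lie_groupoid R) (x : obj G) :
    cochain R :=
  let T := fun i : nat => match i with
           | 1 => dual (tangent (obj G))
           | 2 => dual (algebroid x)
           | _ => zero_space R
           end in
  @Cochain R T (fun i => match i return 'Hom(T i, T i.+1) with
                         | 1 => - dual_map (anchor x)
                         | _ => 0
                         end).

Definition tangent_to_cotangent (R : realType) (G : lie_groupoid R)
    (om : two_form (obj G)) (x : obj G) (i : nat) :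
    'Hom(term (tangent_complex x) i, term (cotangent_complex x) i) :=
  match i return
    'Hom(term (tangent_complex x) i, term (cotangent_complex x) i) with
  | 1 => flat om x
  | _ => 0
  end.

(* Quasi-isomorphisms of complexes of vector bundles are fibrewise ones. *)
Definition nondegenerate (R : realType) (G : lie_groupoid R)
    (om : two_form (obj G)) : Prop :=
  forall x : obj G, quasi_iso (tangent_to_cotangent om x).

Definition symplectic0 (R : realType) (G : lie_groupoid R)
    (om : two_form (obj G)) : Prop :=
  [/\ closed_form om, pullback (@src R G) om = pullback (@tgt R G) om &
      nondegenerate om].


(* A k-shifted 2-form has components in Omega^(2+k-i)(H_i) for 0 <= i <= k, so
   the (-1)-shifted ones form the zero space, and their total differential is
   the zero 0-shifted 2-form. *)
Definition shifted_form_m1 (R : realType) (H : lie_groupoid R) : vectType R :=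
  zero_space R.

Definition total_diff_m1 (R : realType) (H : lie_groupoid R)
    (sigma : shifted_form_m1 H) : form_fun (obj H) :=
  zero_form (obj H).

Definition isotropic_structure (R : realType) (H G : lie_groupoid R)
    (om : two_form (obj G)) (Phi : lie_morphism H G)
    (sigma : shifted_form_m1 H) : Prop :=
  total_diff_m1 sigma = pullback (mor_obj Phi) om.

Definition isotropic (R : realType) (H G : lie_groupoid R)
    (om : two_form (obj G)) (Phi : lie_morphism H G) : Prop :=
  exists sigma, isotropic_structure om Phi sigma.

(* A_H -> TN (+) phi^*A_G -> phi^*TM -> 0, at y *)
Definition normal_complex (R : realType) (H G : lie_groupoid R)
    (Phi : lie_morphism H G) (y : obj H) : cochain R :=
  let x := mor_obj Phi y in
  let T := fun i : nat => match i with
           | 0 => algebroid y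
           | 1 => (tangent (obj H) * algebroid x)%type : vectType R
           | 2 => tangent (obj G)
           | _ => zero_space R
           end in
  @Cochain R T (fun i => match i return 'Hom(T i, T i.+1) with
    | 0 => linfun (fun v : algebroid y => (anchor y v, lie_map Phi y v))
    | 1 => linfun (fun p : (tangent (obj H) * algebroid x)%type =>
                     tmap (mor_obj Phi) y p.1 - anchor x p.2)
    | _ => 0
    end).

Definition shift1 (R : realType) (C : cochain R) : cochain R :=
  let T := fun i : nat => match i with
           | 0 => zero_space R
           | j.+1 => term C j
           end in
  @Cochain R T (fun i => match i return 'Hom(T i, T i.+1) with
                         | 0 => 0
                         | j.+1 => cdiff C j
                         end).

Definition normal_to_cotangent (R : realType) (H G : lie_groupoid R)
    (om : two_form (obj G)) (Phi : lie_morphism H G) (y : obj H) (i : nat) :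
    'Hom(term (normal_complex Phi y) i, term (shift1 (cotangent_complex y)) i) :=
  match i return
    'Hom(term (normal_complex Phi y) i, term (shift1 (cotangent_complex y)) i)
  with
  | 2 => (dual_map (tmap (mor_obj Phi) y) \o flat om (mor_obj Phi y))%VF
  | _ => 0
  end.

Definition lagrangian (R : realType) (H G : lie_groupoid R)
    (om : two_form (obj G)) (Phi : lie_morphism H G) : Prop :=
  isotropic om Phi /\ forall y : obj H, quasi_iso (normal_to_cotangent om Phi y).

(* Main.v *)
(* The chain rule at units gives T phi o a_H = a_G o Lie(Phi), so at each point
   the claim is linear algebra. Write a, b, f for a_H, a_G, T phi. Nondegeneracy
   says that b is injective and ker omega = im b, so h = f^* o omega and
   omega o f have, by skew-symmetry, the same rank. If TN / im a injects into
   TM / im b, then ker (omega o f) = im a and this common rank is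
   rank TN - rank a; comparing dimensions, ker h = im (f - b) amounts to the
   half-rank condition, and exactness at T^*N and A_H^* is then automatic. *)
From HB Require Import structures.
Require Import Defs.
From mathcomp Require Import all_boot all_order all_algebra.
From mathcomp Require Import all_classical all_reals all_analysis.
From mathcomp Require Import zify.
Import Order.TTheory GRing.Theory Num.Theory.
Import numFieldNormedType.Exports.
Local Open Scope ring_scope.

(** The definitions apply [linfun] to bare functions, whose values are recovered only once linearity
    is proved and bundled. *)
Lemma linfun_linearE {K : fieldType} {aT rT : vectType K} (f : aT -> rT) :
  linear f -> linfun f =1 f.
Proof.
move=> lf v.
pose F : {linear aT -> rT} := HB.pack f (GRing.isLinear.Build K aT rT *:%R f lf).
exact: (lfunE F v).
Qed.

Lemma limgN {K : fieldType} {aT rT : vectType K} (f : 'Hom(aT, rT)) :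
  limg (- f)%R = limg f.
Proof.
apply/eqP; rewrite eqEsubv; apply/andP; split; apply/subvP => _ /memv_imgP[v _ ->];
  apply/memv_imgP; exists (- v); rewrite ?memvf // opp_lfunE linearN //.
by rewrite opprK.
Qed.

(** * Chain rule for tangent maps in the chosen charts *)

Section Tangent.
Context {R : realType}.

Definition local_rep {M N : manifold R} (f : M -> N) (p : M) :
    'rV[R]_(mdim M) -> 'rV[R]_(mdim N) :=
  chart_map (chart_at (f p)) \o f \o chart_inv (chart_at p).

Lemma tmapE {M N : manifold R} (f : M -> N) (p : M) (v : tangent M) :
  tmap f p v = 'd (local_rep f p) (chart_map (chart_at p) p) v.
Proof. by rewrite /tmap lfunE. Qed.

Lemma local_rep_at {M N : manifold R} (f : M -> N) (p : M) :
  local_rep f p (chart_map (chart_at p) p) = chart_map (chart_at (f p)) (f p).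
Proof. by rewrite /local_rep /= chart_mapK //; exact: chart_at_dom. Qed.

Lemma local_rep_differentiable {M N : manifold R} (f : M -> N) (p : M) :
  smooth_map f -> differentiable (local_rep f p) (chart_map (chart_at p) p).
Proof.
move=> [_ sf].
have [+ _] := sf _ _ (chart_at_atlas p) (chart_at_atlas (f p)) 1%N.
apply; split; first exact/chart_map_cod/chart_at_dom.
by rewrite /= chart_mapK; exact: chart_at_dom.
Qed.

(** The composite on the left inserts the chart around [f p] and its inverse. They cancel wherever
    [f] lands in the domain of that chart, and continuity makes this a neighbourhood. *)
Lemma local_rep_comp {M N P : manifold R} (f : M -> N) (g : N -> P) (p : M) :
  smooth_map f ->
  \forall z \near chart_map (chart_at p) p,
    (local_rep g (f p) \o local_rep f p) z = local_rep (g \o f) p z.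
Proof.
move=> [cf _]; set c := chart_at p.
have cp : chart_dom c p by exact: chart_at_dom.
have cinv : {for chart_map c p, continuous (chart_inv c)}.
  exact/chart_inv_cont/chart_map_cod.
have fdom : nbhs (f p) (chart_dom (chart_at (f p))).
  by apply: open_nbhs_nbhs; split; [exact: chart_dom_open|exact: chart_at_dom].
have : nbhs (chart_map c p)
    ((f \o chart_inv c) @^-1` chart_dom (chart_at (f p)))%classic.
  apply: (@continuous_comp _ _ _ (chart_inv c) f) => //.
    exact: cf.
  by rewrite /= chart_mapK.
by apply: filterS => z /= zdom; rewrite /local_rep /= chart_mapK.
Qed.

(** The right-hand side is a directional derivative because that depends only on the germ of the
    function: [local_rep_comp] then reduces the claim to the chain rule for the two
    representatives. *)
Lemma tmap_comp {M N P : manifold R} (f : M -> N) (g : N -> P) (p : M)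
    (v : tangent M) :
  smooth_map f -> smooth_map g ->
  tmap g (f p) (tmap f p v) = 'D_v (local_rep (g \o f) p) (chart_map (chart_at p) p).
Proof.
move=> sf sg; rewrite !tmapE -local_rep_at.
have df := local_rep_differentiable _ p sf.
have dg : differentiable (local_rep g (f p))
    (local_rep f p (chart_map (chart_at p) p)).
  by rewrite local_rep_at; exact: local_rep_differentiable.
rewrite -(near_eq_derive _ (local_rep_comp f g p sf)) deriveE.
  by rewrite diff_comp.
exact: differentiable_comp.
Qed.

(** Both sides are derivatives of one composite map. The equation is well typed because [tangent]
    does not depend on the base point. *)
Lemma tmap_square {M N N' P : manifold R} (f : M -> N) (g : N -> P)
    (f' : M -> N') (g' : N' -> P) (p : M) (v : tangent M) :
  smooth_map f -> smooth_map g -> smooth_map f' -> smooth_map g' ->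
  (forall q, g (f q) = g' (f' q)) ->
  tmap g (f p) (tmap f p v) = tmap g' (f' p) (tmap f' p v).
Proof.
move=> sf sg sf' sg' e; rewrite !tmap_comp //.
by have -> : g \o f = g' \o f' by apply/funext => q; exact: e.
Qed.

End Tangent.

(** * Anchors and the algebroid map Lie(Phi) *)

Lemma anchorE {R : realType} {G : lie_groupoid R} (x : obj G) (v : algebroid x) :
  anchor x v = tmap (@tgt R G) (gunit x) (vsval v).
Proof. by rewrite /anchor linfun_linearE // => a u w; rewrite !linearP. Qed.

Section Algebroid.
Variables (R : realType) (H G : lie_groupoid R) (Phi : lie_morphism H G).

(** Differentiating [mor_src] at a unit shows that the tangent map of [mor_arr] preserves the
    kernels of T s, so [vsproj] changes nothing. *)
Lemma lie_mapE (y : obj H) (v : algebroid y) :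
  vsval (lie_map Phi y v) = tmap (mor_arr Phi) (gunit y) (vsval v).
Proof.
rewrite /lie_map linfun_linearE => [|a u w]; last by rewrite !linearP.
rewrite vsprojK // memv_ker -(mor_unit Phi).
apply/eqP; rewrite (tmap_square _ _ (@src R H) (mor_obj Phi)).
- have /eqP -> : tmap (@src R H) (gunit y) (vsval v) == 0.
    by rewrite -memv_ker; exact: subvsP.
  by rewrite linear0.
- exact: mor_arr_smooth.
- exact: src_smooth.
- exact: src_smooth.
- exact: mor_obj_smooth.
- exact: mor_src.
Qed.

(** Obtained by differentiating [mor_tgt] at a unit; this supplies the hypothesis [bL] of the
    fibrewise algebra. *)
Lemma anchor_lie_map (y : obj H) (v : algebroid y) :
  anchor (mor_obj Phi y) (lie_map Phi y v) = tmap (mor_obj Phi) y (anchor y v).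
Proof.
rewrite !anchorE lie_mapE -(mor_unit Phi).
rewrite (tmap_square _ _ (@tgt R H) (mor_obj Phi)) ?tgt_unit //.
- exact: mor_arr_smooth.
- exact: tgt_smooth.
- exact: tgt_smooth.
- exact: mor_obj_smooth.
- exact: mor_tgt.
Qed.

End Algebroid.

(** * Dual maps and ranks of transposes *)

Section Duality.
Context {R : realType}.

Lemma dim_prod (V W : vectType R) :
  \dim {: (V * W)%type : vectType R} = (\dim {: V} + \dim {: W})%N.
Proof. by rewrite !dimvf. Qed.

Lemma dim_dual (V : vectType R) : \dim {: dual V} = \dim {: V}.
Proof. by rewrite !dimvf /dim /= muln1. Qed.

Lemma dual_mapE {V W : vectType R} (f : 'Hom(V, W)) (xi : 'Hom(W, R^o)) :
  dual_map f xi = (xi \o f)%VF.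
Proof.
rewrite /dual_map linfun_linearE // => a u v.
by rewrite comp_lfunDl comp_lfunZl.
Qed.

Lemma rank_nullity {V W : vectType R} (f : 'Hom(V, W)) :
  (\dim (lker f) + \dim (limg f))%N = \dim {: V}.
Proof. by rewrite -(limg_ker_dim f fullv) capfv. Qed.

Lemma lker_dual_map {V W : vectType R} (f : 'Hom(V, W)) (xi : 'Hom(W, R^o)) :
  reflect (forall v, xi (f v) = 0) (xi \in lker (dual_map f)).
Proof.
rewrite memv_ker dual_mapE; apply: (iffP eqP) => [e v|e].
  by rewrite -comp_lfunE e lfunE.
by apply/lfunP => v; rewrite comp_lfunE e lfunE.
Qed.

(** Precomposing a form on [V] with the left inverse of [f] gives a preimage. *)
Lemma dual_map_surj {V W : vectType R} (f : 'Hom(V, W)) :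
  injective f -> limg (dual_map f) = fullv.
Proof.
move=> /lker0P/lker0_compVf fK; apply/eqP; rewrite eqEsubv subvf /=.
apply/subvP => xi _; apply/memv_imgP; exists (xi \o f^-1)%VF; first exact: memvf.
by rewrite dual_mapE -comp_lfunA fK comp_lfun1r.
Qed.

(** [h] and [g] are the two curried forms of one pairing. With [U] the image of [h], [g] factors
    through the dual of [U]: first evaluate elements of [U] at [w], then apply the transpose of
    [V -> U]. Hence its rank is at most the dimension of [U]. *)
Lemma dim_limg_flip_le {V W : vectType R} (h : 'Hom(V, dual W))
    (g : 'Hom(W, dual V)) :
  (forall v w, (g w : 'Hom(V, R^o)) v = (h v : 'Hom(W, R^o)) w) ->
  (\dim (limg g) <= \dim (limg h))%N.
Proof.
move=> gh; pose U := limg h.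
have Uh v : h v \in U by exact/memv_img/memvf.
pose p : 'Hom(V, subvs_of U) := linfun (vsproj U \o h).
pose k (w : W) : 'Hom(subvs_of U, R^o) :=
  linfun (fun u : subvs_of U => (vsval u : 'Hom(W, R^o)) w : R^o).
have kE w u : k w u = (vsval u : 'Hom(W, R^o)) w.
  rewrite linfun_linearE // => a u1 u2.
  by rewrite linearP add_lfunE scale_lfunE.
pose K : 'Hom(W, dual (subvs_of U)) := linfun (k : W -> dual (subvs_of U)).
have KE w : K w = k w.
  rewrite linfun_linearE // => a w1 w2.
  by apply/lfunP => u; rewrite add_lfunE scale_lfunE !kE linearP.
have -> : g = (dual_map p \o K)%VF.
  apply/lfunP => w; rewrite comp_lfunE dual_mapE KE; apply/lfunP => v.
  by rewrite comp_lfunE kE lfunE /= vsprojK.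
rewrite limg_comp; 
apply: leq_trans (_ : \dim {: dual (subvs_of U)} <= _)%N; last first.
  by rewrite dim_dual dimvf.
apply: leq_trans (dimvS (subvf (limg K))).
by rewrite -(limg_ker_dim (dual_map p) (limg K)) leq_addl.
Qed.

Lemma dim_limg_flip {V W : vectType R} (h : 'Hom(V, dual W))
    (g : 'Hom(W, dual V)) :
  (forall v w, (g w : 'Hom(V, R^o)) v = (h v : 'Hom(W, R^o)) w) ->
  \dim (limg g) = \dim (limg h).
Proof.
by move=> gh; apply/eqP; rewrite eqn_leq !dim_limg_flip_le.
Qed.

End Duality.

(** * Linear algebra of the normal sequence at one point *)

Section Fibre.
Context {R : realType} {A V B W : vectType R}.
Variables (a : 'Hom(A, V)) (b : 'Hom(B, W)) (f : 'Hom(V, W)) (L : 'Hom(A, B)).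
Variables (om : 'Hom(W, dual W)).

(** Like [normal_d1], an abstract copy of a differential of [normal_complex], to which it
    specializes by conversion. *)
Definition normal_d0 : 'Hom(A, (V * B)%type : vectType R) :=
  linfun (fun v : A => (a v, L v)).

Definition normal_d1 : 'Hom((V * B)%type : vectType R, W) :=
  linfun (fun p : (V * B)%type => f p.1 - b p.2).

(** The sign of the last map is dropped, as it affects neither kernel nor image. *)
Definition exact_normal_sequence : Prop :=
  [/\ lker normal_d0 = 0%VS, lker normal_d1 = limg normal_d0,
      lker (dual_map f \o om)%VF = limg normal_d1,
      lker (dual_map a) = limg (dual_map f \o om)%VF &
      limg (dual_map a) = fullv].

Lemma normal_d0E v : normal_d0 v = (a v, L v).
Proof. by rewrite /normal_d0 linfun_linearE // => c u w; rewrite !linearP. Qed.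

Lemma normal_d1E p : normal_d1 p = f p.1 - b p.2.
Proof.
rewrite /normal_d1 linfun_linearE // => c u w.
by rewrite /= !linearP scalerDr addrACA.
Qed.

Lemma dual_map_compE u v :
  ((dual_map f \o om)%VF u : 'Hom(V, R^o)) v = (om u : 'Hom(W, R^o)) (f v).
Proof. by rewrite comp_lfunE dual_mapE comp_lfunE. Qed.

Hypothesis om_skew : forall u v,
  (om u : 'Hom(W, R^o)) v = - (om v : 'Hom(W, R^o)) u.
Hypothesis om_ker : lker om = limg b.
Hypothesis b_inj : injective b.
Hypothesis bL : forall v, b (L v) = f (a v).
Hypothesis f_isotropic : forall u v, (om (f u) : 'Hom(W, R^o)) (f v) = 0.

Lemma om_b q : om (b q) = 0.
Proof. by apply/eqP; rewrite -memv_ker om_ker memv_img ?memvf. Qed.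

Lemma normal_d1_d0 v : normal_d1 (normal_d0 v) = 0.
Proof. by rewrite normal_d0E normal_d1E /= bL subrr. Qed.

Lemma limg_normal_d0_sub : (limg normal_d0 <= lker normal_d1)%VS.
Proof.
by apply/subvP => _ /memv_imgP[v _ ->]; rewrite memv_ker normal_d1_d0.
Qed.

Lemma limg_normal_d1_sub : (limg normal_d1 <= lker (dual_map f \o om)%VF)%VS.
Proof.
apply/subvP => _ /memv_imgP[[u q] _ ->]; rewrite memv_ker normal_d1E /=.
apply/eqP/lfunP => v.
by rewrite dual_map_compE linearB /= om_b subr0 f_isotropic lfunE.
Qed.

Lemma limg_dual_map_sub : (limg (dual_map f \o om)%VF <= lker (dual_map a))%VS.
Proof.
apply/subvP => _ /memv_imgP[u _ ->]; apply/lker_dual_map => v.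
by rewrite dual_map_compE -bL om_skew om_b lfunE oppr0.
Qed.

(** Since ker om = im b, the preimage of im b under [f] is ker (om f); it contains im a by [bL], and
    the induced map is injective exactly when there is nothing more. *)
Lemma quot_injectiveP :
  quot_injective f (limg a) (limg b) <-> lker (om \o f)%VF = limg a.
Proof.
have mem_ker v : (v \in lker (om \o f)%VF) = (f v \in limg b).
  by rewrite memv_ker comp_lfunE -om_ker memv_ker.
split=> [qi|e u v].
  apply/eqP; rewrite eqEsubv; apply/andP; split; apply/subvP => v.
    by rewrite mem_ker => fv; rewrite -[v]subr0; apply: qi; rewrite linear0 subr0.
  by case/memv_imgP => z _ ->; rewrite mem_ker -bL memv_img ?memvf.
by rewrite -linearB -mem_ker e.
Qed.

Lemma lker_normal_d0 : injective a -> lker normal_d0 = 0%VS.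
Proof.
move=> a_inj; apply/eqP/lker0P => u v.
by rewrite !normal_d0E => -[/a_inj].
Qed.

(** As [b] is injective and b L = f a, the value of [a] determines that of [L]. *)
Lemma lker_normal_d0_anchor : lker normal_d0 = 0%VS -> injective a.
Proof.
move=> /eqP/lker0P d0_inj u v e; apply: d0_inj.
by rewrite !normal_d0E e; congr pair; apply: b_inj; rewrite !bL e.
Qed.

(** The kernel of f - b consists of the pairs with f u = b q. Injectivity of [b] makes [q] a
    function of [u], so only the range of [u] matters: the preimage of im b on one side, im a on the
    other. *)
Lemma quot_injective_lker_normal_d1 :
  quot_injective f (limg a) (limg b) <-> lker normal_d1 = limg normal_d0.
Proof.
split=> [qi|e u v].
  apply/eqP; rewrite eqEsubv limg_normal_d0_sub andbT.
  apply/subvP => -[u q]; rewrite memv_ker normal_d1E subr_eq0 => /eqP /= fu.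
  have /memv_imgP[v _ ua] : u \in limg a.
    rewrite -[u]subr0; apply: qi.
    by rewrite linear0 subr0 fu memv_img ?memvf.
  apply/memv_imgP; exists v; rewrite ?memvf // normal_d0E -ua; congr pair.
  by apply: b_inj; rewrite bL -ua.
rewrite -linearB => /memv_imgP[q _ fuv].
have : (u - v, q) \in lker normal_d1.
  by rewrite memv_ker normal_d1E /= fuv subrr.
rewrite e => /memv_imgP[z _]; rewrite normal_d0E => -[-> _].
by rewrite memv_img ?memvf.
Qed.

Lemma rank_om_f : \dim (limg (dual_map f \o om)%VF) = \dim (limg (om \o f)%VF).
Proof.
rewrite (@dim_limg_flip _ _ _ (- (om \o f))%VF) => [|v w].
  by rewrite limgN.
by rewrite dual_map_compE om_skew opp_lfunE comp_lfunE opp_lfunE.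
Qed.

Lemma exact_normal_sequenceP :
  exact_normal_sequence <->
  [/\ injective a, quot_injective f (limg a) (limg b) &
      quot_rank (limg b) = (quot_rank (limg a)).*2].
Proof.
have dimB : \dim (limg b) = \dim {: B}.
  by have /lker0P/eqP kb := b_inj; rewrite -(rank_nullity b) kb dimv0.
(* These bounds make the truncated subtractions in [quot_rank] genuine differences for [lia]. *)
have leV : (\dim (limg a) <= \dim {: V})%N by rewrite dimvS ?subvf.
have leW : (\dim (limg b) <= \dim {: W})%N by rewrite dimvS ?subvf.
(* The dimension relations shared by both directions of the equivalence. *)
have dims : injective a -> quot_injective f (limg a) (limg b) ->
    [/\ \dim (limg a) = \dim {: A},
        (\dim (limg a) + \dim (limg normal_d1) = \dim {: V} + \dim (limg b))%N,
        (\dim (limg a) + \dim (limg (dual_map f \o om)%VF) = \dim {: V})%N &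
        (\dim (lker (dual_map f \o om)%VF) +
           \dim (limg (dual_map f \o om)%VF) = \dim {: W})%N].
  move=> a_inj qi.
  have dimA : \dim (limg a) = \dim {: A}.
    by have /lker0P/eqP ka := a_inj; rewrite -(rank_nullity a) ka dimv0.
  split=> //; last exact: rank_nullity.
    (* Rank-nullity for f - b: its kernel is the injective image of [A], of dimension rank a. *)
    rewrite dimB -dim_prod -(rank_nullity normal_d1); congr addn.
    have /quot_injective_lker_normal_d1 -> := qi.
    by rewrite dimA -(rank_nullity normal_d0) lker_normal_d0 // dimv0.
  rewrite rank_om_f -(rank_nullity (om \o f)%VF).
  by have /quot_injectiveP -> := qi.
split=> [[d0_inj ex1 ex2 _ _]|[a_inj qi rk]].
  have a_inj := lker_normal_d0_anchor d0_inj.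
  have /quot_injective_lker_normal_d1 qi := ex1.
  split=> //; have [_ e1 e2 e3] := dims a_inj qi.
  (* With ker h = im (f - b), adding up gives dim W - rank b = 2 (dim V - rank a). *)
  by rewrite /quot_rank; rewrite ex2 in e3; lia.
have [dimA e1 e2 e3] := dims a_inj qi; rewrite /quot_rank in rk.
have a_surj := dual_map_surj a a_inj.
split=> //; [exact: lker_normal_d0|exact/quot_injective_lker_normal_d1| |].
  (* The inclusion always holds, and the half-rank condition equates the dimensions. *)
  apply/eqP; rewrite eq_sym eqEdim limg_normal_d1_sub /=; lia.
apply/eqP; rewrite eq_sym eqEdim limg_dual_map_sub /=.
(* The kernel of the surjection a^* has dimension dim V - dim A = dim V - rank a, which is the rank
   of h. *)
have := rank_nullity (dual_map a); rewrite a_surj !dim_dual; lia.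
Qed.

End Fibre.

(** * The two-form as a skew-symmetric linear map *)

Lemma zero_space_eq {R : realType} (u v : zero_space R) : u = v.
Proof. by apply/rowP => -[]. Qed.

Lemma flatE {R : realType} {M : manifold R} (om : two_form M) (x : M)
    (v w : tangent M) :
  (flat om x v : 'Hom(tangent M, R^o)) w = form_val om x v w.
Proof.
have lin_r u : linear (fun z : tangent M => form_val om x u z : R^o).
  by move=> c z1 z2; exact: form_linear_r.
rewrite /flat linfun_linearE => [|c u1 u2]; first by rewrite linfun_linearE.
apply/lfunP => z; rewrite add_lfunE scale_lfunE !linfun_linearE //.
exact: form_linear_l.
Qed.

Lemma form_skew {R : realType} {M : manifold R} (om : two_form M) (x : M)
    (v w : tangent M) : form_val om x v w = - form_val om x w v.
Proof.
have := form_alternating om x (v + w).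
have := form_linear_l om x (v + w) 1 v w; rewrite scale1r mul1r => ->.
have := form_linear_r om x v 1 v w; rewrite scale1r mul1r => ->.
have := form_linear_r om x w 1 v w; rewrite scale1r mul1r => ->.
by rewrite !form_alternating add0r addr0 => /eqP; rewrite addr_eq0 => /eqP.
Qed.

(** * Quasi-isomorphisms read as exactness *)

Section Lagrangian.
Context {R : realType} {G : lie_groupoid R} (om : two_form (obj G)).

(** Injectivity on H^0, where the target is zero, kills ker a_G. On H^1 = TM / im a_G it gives ker
    om inside im a_G; the chain map condition gives the reverse inclusion. *)
Lemma nondegenerate_anchor : Defs.nondegenerate om -> forall x : obj G,
  injective (anchor x) /\ lker (flat om x) = limg (anchor x).
Proof.
move=> nd x; have [_ _ cm inj _] := nd x; split.
  apply/lker0P; rewrite -subv0; apply/subvP => v kv.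
  rewrite -[v]subr0; apply: (inj 0%N) => //; first exact: mem0v.
  by rewrite !lfunE subrr mem0v.
apply/eqP; rewrite eqEsubv; apply/andP; split; apply/subvP => v.
  move=> kv; rewrite -[v]subr0; apply: (inj 1%N).
  - by rewrite /cocycles memv_ker /= lfunE.
  - exact: mem0v.
  - by move: kv; rewrite memv_ker /= linear0 subr0 => /eqP ->; rewrite mem0v.
case/memv_imgP => u _ ->; rewrite memv_ker.
by have := cm 0%N u; rewrite /= !lfunE /= => <-.
Qed.

Variables (H : lie_groupoid R) (Phi : lie_morphism H G).

Lemma isotropicP :
  isotropic om Phi <-> pullback (mor_obj Phi) om = zero_form (obj H).
Proof. by split=> [[_ <-]//|e]; exists 0; rewrite /isotropic_structure e. Qed.

(** The chain map is nonzero only in degree 2, where T^*N sits after the shift. So H^0 and H^1 of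
    the normal complex must vanish, coker (f - b) must map isomorphically onto ker a_H^*, and a_H^*
    must be onto. *)
Lemma quasi_isoP (y : obj H) :
  quasi_iso (normal_to_cotangent om Phi y) <->
  exact_normal_sequence (anchor y) (anchor (mor_obj Phi y))
    (tmap (mor_obj Phi) y) (lie_map Phi y) (flat om (mor_obj Phi y)).
Proof.
set x := mor_obj Phi y; set f := tmap (mor_obj Phi) y.
set h := (dual_map f \o flat om x)%VF.
pose d0 := normal_d0 (anchor y) (lie_map Phi y).
pose d1 := normal_d1 (anchor x) f.
rewrite /exact_normal_sequence -/h -/d0 -/d1; split.
  move=> [cC cD cm inj sur]; split.
  - apply/eqP; rewrite -subv0; apply/subvP => v kv.
    rewrite -[v]subr0; apply: (inj 0%N) => //; first exact: mem0v.
    by rewrite !lfunE subrr mem0v.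
  - apply/eqP; rewrite eqEsubv; apply/andP; split; apply/subvP => v.
      move=> kv; rewrite -[v]subr0; apply: (inj 1%N) => //; first exact: mem0v.
      by rewrite !lfunE subrr mem0v.
    by case/memv_imgP => u _ ->; rewrite memv_ker; apply/eqP; exact: (cC 0%N).
  - apply/eqP; rewrite eqEsubv; apply/andP; split; apply/subvP => v.
      move=> kv; rewrite -[v]subr0; apply: (inj 2%N).
      + by rewrite /cocycles memv_ker /= lfunE.
      + exact: mem0v.
      + by move: kv; rewrite memv_ker /= linear0 subr0 => /eqP ->; rewrite mem0v.
    case/memv_imgP => u _ ->; rewrite memv_ker.
    by have := cm 1%N u; rewrite /= !lfunE /= => <-.
  - apply/eqP; rewrite eqEsubv; apply/andP; split; apply/subvP => v.
      (* Surjectivity on H^2 yields a preimage up to a coboundary, which is zero because T^*N is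
         preceded by 0. *)
      move=> kv; have [|w _] := sur 2%N v.
        by move: kv; rewrite /cocycles /= !memv_ker opp_lfunE oppr_eq0.
      rewrite /= => /memv_imgP[z _]; rewrite zero_lfunE /= => /eqP.
      rewrite subr_eq0 => /eqP <-.
      by rewrite memv_img ?memvf.
    case/memv_imgP => u _ ->; rewrite memv_ker.
    have := cm 2%N u; rewrite /= opp_lfunE !lfunE /= => /eqP.
    by rewrite oppr_eq0.
  - apply/eqP; rewrite eqEsubv subvf /=; apply/subvP => v _.
    (* In degree 3 everything is a cocycle and the source is 0, so every element is a coboundary. *)
    have [|w _] := sur 3%N v; first by rewrite /cocycles memv_ker /= lfunE.
    by rewrite /= lfunE sub0r memvN limgN.
move=> [d0_inj ex1 ex2 ex3 a_surj].
have d1d0 v : d1 (d0 v) = 0.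
  by apply/eqP; rewrite -memv_ker ex1 memv_img ?memvf.
have hd1 v : h (d1 v) = 0.
  by apply/eqP; rewrite -memv_ker ex2 memv_img ?memvf.
have ah v : dual_map (anchor y) (h v) = 0.
  by apply/eqP; rewrite -memv_ker ex3 memv_img ?memvf.
(* Each clause is checked degree by degree; outside the degrees of the sequence the terms are
   [zero_space]. *)
split.
- by case=> [|i] v; [exact: d1d0|exact: zero_lfunE].
- by case=> [|[|[|i]]] v; do ?[exact: zero_lfunE]; rewrite /= zero_lfunE linear0.
- case=> [|[|[|i]]] v.
  + by rewrite /= !zero_lfunE.
  + by rewrite [LHS]zero_lfunE; symmetry; exact: hd1.
  + by rewrite [RHS]zero_lfunE /= opp_lfunE ah oppr0.
  + by rewrite /= !zero_lfunE.
- case=> [|[|[|i]]] v w kv kw.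
  + have : v - w \in lker d0 by rewrite memvB.
    by rewrite d0_inj.
  + have : v - w \in lker d1 by rewrite memvB.
    by rewrite ex1.
  + rewrite /= -linearB => /memv_imgP[z _]; rewrite zero_lfunE /= => e.
    by rewrite -ex2 memv_ker e.
  + by move=> _; rewrite (zero_space_eq (v - w) 0) mem0v.
- case=> [|[|[|[|i]]]] v kv.
  + by exists 0; rewrite ?mem0v // (zero_space_eq (_ - _) 0) mem0v.
  + by exists 0; rewrite ?mem0v // (zero_space_eq (_ - _) 0) mem0v.
  + have : v \in limg h.
      by rewrite -ex3; move: kv; rewrite /cocycles !memv_ker /= opp_lfunE oppr_eq0.
    case/memv_imgP => u _ ->; exists u; first by rewrite /cocycles memv_ker /= lfunE.
    by rewrite subrr mem0v.
  + by exists 0; rewrite ?mem0v //= lfunE sub0r memvN limgN a_surj memvf.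
  + by exists 0; rewrite ?mem0v // (zero_space_eq (_ - _) 0) mem0v.
Qed.

Lemma lagrangian_fibreP (y : obj H) :
  Defs.nondegenerate om -> pullback (mor_obj Phi) om = zero_form (obj H) ->
  quasi_iso (normal_to_cotangent om Phi y) <->
  [/\ injective (anchor y),
      quot_injective (tmap (mor_obj Phi) y)
        (limg (anchor y)) (limg (anchor (mor_obj Phi y))) &
      quot_rank (limg (anchor (mor_obj Phi y)))
        = (quot_rank (limg (anchor y))).*2].
Proof.
move=> nd iso; have [b_inj kom] := nondegenerate_anchor nd (mor_obj Phi y).
rewrite quasi_isoP; apply: exact_normal_sequenceP => //.
- by move=> u v; rewrite !flatE form_skew.
- exact: anchor_lie_map.
- move=> u v; rewrite flatE.
  by have := congr1 (fun F : form_fun (obj H) => F y u v) iso.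
Qed.

End Lagrangian.

(** Translates the halving in [rat] into the doubling in [nat] used by the dimension count. *)
Lemma half_natP (m n : nat) :
  (m%:R = 2^-1 * n%:R :> rat) <-> n = m.*2.
Proof.
rewrite -muln2; split=> [e|->]; last by rewrite natrM mulrC mulfK.
by apply/eqP; rewrite -(eqr_nat rat) natrM e mulrAC mulVf // mul1r.
Qed.

Theorem proposition2p20 (R : realType) (G : lie_groupoid R)
    (om : two_form (obj G)) (om_symplectic : symplectic0 om)
    (H : lie_groupoid R) (Phi : lie_morphism H G) :
  let phi := mor_obj Phi in
  (isotropic om Phi <-> pullback phi om = zero_form (obj H)) /\
  (lagrangian om Phi <->
     [/\ pullback phi om = zero_form (obj H),
         (forall y : obj H, injective (anchor y)),
         (forall y : obj H, quot_injective (tmap phi y)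
            (limg (anchor y)) (limg (anchor (phi y)))) &
         (forall y : obj H,
            (quot_rank (limg (anchor y)))%:R
              = 2^-1 * (quot_rank (limg (anchor (phi y))))%:R :> rat)]).
Proof.
move=> phi; have [_ _ nd] := om_symplectic.
(* Once isotropy is known, both sides of the lagrangian clause are conditions at each point of N. *)
have fibre (y : obj H) := lagrangian_fibreP om H Phi y nd.
split; first exact: isotropicP.
split=> [[/isotropicP iso qi]|[iso a_inj q_inj rk]].
  by split=> // y; have [? ? /half_natP] := (fibre y iso).1 (qi y).
split=> [|y]; first exact/isotropicP.
by apply/(fibre y iso); split=> //; exact/half_natP.
Qed.
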